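(* Let $\mathcal{O}$ be the ring of an algebroid curve with $r\ge 3$ minimal primes, $I=\{1,\dots,r\}$, $I'=\{1,\dots,r-1\}$. Let $\mathcal{I}$ be a fractional ideal of $\mathcal{O}$ with value set $E$, let $\alpha^0=\min E$, and let $\gamma\in\mathbb{Z}^r$ with $\gamma\geq c(E)$. Then $$\ell\left(\frac{\mathcal{I}}{\mathcal{I}(\gamma)}\right)=\ell\left(\frac{\pi_{I'}(\mathcal{I})}{\pi_{I'}(\mathcal{I})(pr_{I'}(\gamma))}\right)+(\gamma_r-\alpha^0_r)-\#M(E_r)-\#\Bigg(\bigcup_{r\in J\subseteq I,\ J\neq\{r\}}pr_r\big(RM(E_J)\big)\Bigg).$$
   Context: $\mathbb{N}$ denotes the non-negative integers. The ring of an algebroid curve is a local, reduced, complete $k$-algebra $\mathcal{O}$ of pure dimension one, finitely generated as a complete $k$-algebra (i.e. a quotient of some $k[[X_1,\dots,X_n]]$), where $k$ is an algebraically closed coefficient field of $\mathcal{O}$. Let $\wp_1,\dots,\wp_r$ be its minimal primes, $\mathcal{O}_i=\mathcal{O}/\wp_i$, and $\mathcal{K}_i$ the fraction field of $\mathcal{O}_i$. The integral closure of $\mathcal{O}_i$ in $\mathcal{K}_i$ is isomorphic to $k[[t_i]]$, so $\mathcal{K}_i\simeq k((t_i))$ with its normalized valuation $v_i$ ($v_i(0)=\infty$). Let $\mathcal{K}\simeq\mathcal{K}_1\times\cdots\times\mathcal{K}_r$ be the total ring of fractions of $\mathcal{O}$. For $\emptyset\ne J\subset I$ let $\mathcal{O}_J=\mathcal{O}/\bigcap_{j\in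 J}\wp_j$, with total ring of fractions $\mathcal{K}_J\simeq\prod_{j\in J}\mathcal{K}_j$; let $\pi_J:\mathcal{K}\to\mathcal{K}_J$ be the projection ($\pi_i=\pi_{\{i\}}$), $Z(\mathcal{K}_J)$ the set of elements of $\mathcal{K}_J$ with some zero component, and $v_J=(v_j)_{j\in J}:\mathcal{K}_J\setminus Z(\mathcal{K}_J)\to\mathbb{Z}^{J}$ the value map ($v=v_I$). Let $pr_J:\mathbb{Z}^r\to\mathbb{Z}^{J}$ be the coordinate projection. Coordinates of elements of $\mathbb{Z}^J$ are indexed by the elements of $J$, so for $j\in J$ and $\beta\in\mathbb{Z}^J$, $pr_j(\beta)=\beta_j$. A fractional ideal of $\mathcal{O}$ is an $\mathcal{O}$-submodule $\mathcal{I}$ of $\mathcal{K}$ containing a regular element of $\mathcal{O}$ and such that $d\,\mathcal{I}\subset\mathcal{O}$ for some regular $d\in\mathcal{O}$. Then $\pi_J(\mathcal{I})$ is a fractional ideal of $\mathcal{O}_J$. Its value set is $E=v(\mathcal{I}\setminus Z(\mathcal{K}))\subset\mathbb{Z}^r$, and $E_J=v_J(\pi_J(\mathcal{I})\setminus Z(\mathcal{K}_J))$, $E_i=E_{\{i\}}$. $\mathbb{Z}^r$ carries the componentwise order; $\min E$ is the least element of $E$ (it exists and lies in $E$), and the conductor $c(E)$ is the unique least $\gamma\in E$ with $\gamma+\mathbb{N}^r\subset E$. For $\alpha\in\mathbb{Z}^r$, $\mathcal{I}(\alpha)=\{h\in\mathcal{I}: v_i(\pi_i(h))\ge\alpha_i\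 \forall i\in I\}$; similarly $\pi_{I'}(\mathcal{I})(\alpha')=\{h\in\pi_{I'}(\mathcal{I}): v_i(h_i)\ge\alpha'_i\ \forall i\in I'\}$ for $\alpha'\in\mathbb{Z}^{I'}$. $\ell$ denotes length as $\mathcal{O}$-module. Maximal points: for $\#J\ge2$, $\emptyset\neq K\subset J$ and $\beta\in\mathbb{Z}^J$, put $F_K(E_J,\beta)=\{\theta\in E_J:\theta_i=\beta_i\ \forall i\in K,\ \theta_i>\beta_i\ \forall i\in J\setminus K\}$. A point $\beta\in E_J$ is maximal if $F_{\{i\}}(E_J,\beta)=\emptyset$ for all $i\in J$; a maximal point $\beta$ is a relative maximal if moreover $F_K(E_J,\beta)\neq\emptyset$ for every $K\subset J$ with $\#K\ge2$. $RM(E_J)$ is the set of relative maximals of $E_J$. By convention, for one branch, $M(E_r)$ is the set of gaps of $E_r$, i.e. integers $x>\min E_r$ with $x\notin E_r$. *)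

(* Defs.v *)
From HB Require Import structures.
From mathcomp Require Import all_boot all_order all_algebra.
From mathcomp Require Import ring_quotient mxpoly.
From mathcomp Require Import boolp classical_sets cardinality.

Set Implicit Arguments.
Unset Strict Implicit.
Unset Printing Implicit Defensive.

Import Order.TTheory GRing.Theory Num.Theory.
Local Open Scope classical_set_scope.
Local Open Scope ring_scope.

(** * Formal power series *)

(* R[[t]]: the series a stands for \sum_n a n * t^n. *)
Definition powser (R : comNzRingType) : Type := nat -> R.

HB.instance Definition _ R := gen_eqMixin (powser R).
HB.instance Definition _ R := gen_choiceMixin (powser R).

Definition ps0 (R : comNzRingType) : powser R := fun=> 0.
Definition psopp (R : comNzRingType) (a : powser R) : powser R :=
  fun n => - a n.
Definition psadd (R : comNzRingType) (a b : powser R) : powser R :=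
  fun n => a n + b n.
Definition psC (R : comNzRingType) (c : R) : powser R :=
  fun n => if n == 0%N then c else 0.
Definition psmul (R : comNzRingType) (a b : powser R) : powser R :=
  fun n => \sum_(i < n.+1) a i * b (n - i)%N.

Lemma psaddA R : associative (@psadd R).
Proof. by move=> a b c; apply/funext => n; rewrite /psadd addrA. Qed.
Lemma psaddC R : commutative (@psadd R).
Proof. by move=> a b; apply/funext => n; rewrite /psadd addrC. Qed.
Lemma psadd0 R : left_id (@ps0 R) (@psadd R).
Proof. by move=> a; apply/funext => n; rewrite /psadd add0r. Qed.
Lemma psaddN R : left_inverse (@ps0 R) (@psopp R) (@psadd R).
Proof. by move=> a; apply/funext => n; rewrite /psadd addNr. Qed.

HB.instance Definition _ R := GRing.isZmodule.Build (powser R)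
  (@psaddA R) (@psaddC R) (@psadd0 R) (@psaddN R).

Lemma psmulE (R : comNzRingType) (a b : powser R) (N n : nat) : (n < N)%N ->
  psmul a b n = ((\poly_(i < N) a i) * (\poly_(i < N) b i))`_n.
Proof.
move=> ltnN; rewrite coefM; apply: eq_bigr => i _; rewrite !coef_poly.
by rewrite (leq_ltn_trans _ ltnN) ?leq_ord// (leq_ltn_trans (leq_subr _ _)).
Qed.

Lemma psmulC R : commutative (@psmul R).
Proof.
by move=> a b; apply/funext => n; rewrite !(@psmulE _ _ _ n.+1)// mulrC.
Qed.

Lemma psmulA R : associative (@psmul R).
Proof.
move=> a b c; apply/funext => n; pose T (u : powser R) := \poly_(i < n.+1) u i.
transitivity ((T a * (T b * T c))`_n).
  rewrite coefM; apply: eq_bigr => i _; rewrite coef_poly ltn_ord.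
  by rewrite (@psmulE _ b c n.+1)// ltnS leq_subr.
rewrite mulrA coefM; apply: eq_bigr => i _.
by rewrite -psmulE// coef_poly ltnS leq_subr.
Qed.

Lemma psmul1 R : left_id (psC 1) (@psmul R).
Proof.
move=> a; apply/funext => n; rewrite /psmul big_ord_recl subn0 mul1r.
by rewrite big1 ?addr0// => i _; rewrite /psC /= mul0r.
Qed.

Lemma psmulDl R : left_distributive (@psmul R) (@psadd R).
Proof.
move=> a b c; apply/funext => n; rewrite /psmul /psadd -big_split /=.
by apply: eq_bigr => i _; rewrite mulrDl.
Qed.

Lemma psC1_neq0 (R : comNzRingType) : psC 1 != 0 :> powser R.
Proof. by apply/eqP => /(congr1 (@^~ 0%N)); apply/eqP/oner_neq0. Qed.

HB.instance Definition _ R := GRing.Zmodule_isComNzRing.Build (powser R)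
  (@psmulA R) (@psmulC R) (@psmul1 R) (@psmulDl R) (@psC1_neq0 R).

Definition psX (R : comNzRingType) : powser R :=
  fun n => if n == 1%N then 1 else 0.

(* k[[X_1,...,X_n]], built as k[[X_1,...,X_(n-1)]][[X_n]]. *)
Fixpoint mpowser (k : comNzRingType) (n : nat) : comNzRingType :=
  if n is m.+1 then powser (mpowser k m) else k.

Fixpoint mpsC (k : comNzRingType) (n : nat) : k -> mpowser k n :=
  if n is m.+1 then fun c => psC (mpsC m c) else fun c => c.

(** * Chains, Krull dimension and length *)

(* The longest strict chains X_0 < X_1 < ... < X_n of members of P have exactly
   n steps. *)
Definition longest_chain (T : Type) (P : set (set T)) (n : nat) : Prop :=
  let chain m (X : nat -> set T) :=
    (forall i, (i <= m)%N -> P (X i)) /\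
    (forall i, (i < m)%N -> X i `<` X i.+1) in
  (exists X, chain n X) /\ (forall m X, chain m X -> (m <= n)%N).

Definition prime_ideal (O : comNzRingType) (P : set O) : Prop :=
  idealr_closed (fun x => x \in P) /\ prime_idealr_closed (fun x => x \in P).

Definition minimal_prime (O : comNzRingType) (P : set O) : Prop :=
  prime_ideal P /\ forall Q, prime_ideal Q -> Q `<=` P -> Q = P.

(* dim O/P = d, for an ideal P *)
Definition krull_dim_quotient (O : comNzRingType) (P : set O) (d : nat) :=
  longest_chain [set Q | prime_ideal Q /\ P `<=` Q] d.

Definition ideal_power (O : comNzRingType) (m : set O) (n : nat) : set O :=
  [set x | exists N (c : 'I_N -> O) (f : 'I_N -> 'I_n -> O),
     (forall i j, m (f i j)) /\ x = \sum_i c i * \prod_j f i j].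

(** * Algebroid curves *)

Definition nonunits (O : comUnitRingType) : set O :=
  [set x | x \isn't a GRing.unit].

Definition local_ring (O : comUnitRingType) : Prop :=
  forall x y : O, nonunits x -> nonunits y -> nonunits (x + y).

(* The canonical map from O to the inverse limit of the O/m^n is injective and
   surjective. *)
Definition adically_complete (O : comNzRingType) (m : set O) : Prop :=
  (forall x, (forall n, ideal_power m n x) -> x = 0) /\
  (forall u : nat -> O, (forall n, ideal_power m n (u n.+1 - u n)) ->
     exists l, forall n, ideal_power m n (l - u n)).

Definition algebroid_curve (k : closedFieldType) (O : comUnitAlgType k) :=
  [/\ local_ring O,
      (forall x : O, exists c : k, nonunits (x - c%:A)),
      (forall (x : O) n, x ^+ n = 0 -> x = 0),
      adically_complete (@nonunits O) &
      (forall P : set O, minimal_prime P -> krull_dim_quotient P 1)] /\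
  (exists n (f : {rmorphism mpowser k n -> O}),
     (forall c, f (mpsC n c) = c%:A) /\ (forall x, exists s, f s = x)).

(* phi identifies K with the fraction field of O/P, and tau identifies k[[t]]
   with the integral closure of O/P in K, as k-algebras; K is thus identified
   with k((t)). *)
Definition branch (k : closedFieldType) (O : comUnitAlgType k) (P : set O)
    (K : fieldType) (phi : {rmorphism O -> K}) (tau : {rmorphism powser k -> K})
    : Prop :=
  [/\ (forall a, phi a = 0 <-> P a),
      (forall x, exists a b, phi b != 0 /\ x = phi a / phi b),
      injective tau,
      (forall x, integralOver phi x <-> exists s, tau s = x) &
      (forall c, tau (psC c) = phi c%:A)].

(* v x = n: x is the Laurent series t^n * u with u in k[[t]], u(0) <> 0. This
   forces x != 0; no n satisfies it for x = 0. *)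
Definition val_eq (k : fieldType) (K : fieldType)
    (tau : {rmorphism powser k -> K}) (x : K) (n : int) : Prop :=
  exists2 u : powser k, u 0%N != 0 & x = tau (psX k) ^ n * tau u.

(* v x >= a, with v 0 = infinity *)
Definition val_ge (k : fieldType) (K : fieldType)
    (tau : {rmorphism powser k -> K}) (x : K) (a : int) : Prop :=
  x = 0 \/ exists2 n, a <= n & val_eq tau x n.

(** * Submodules of products of fields

   T is the (finite) set of branches, the product of the K t is the type
   [forall t, K t], and O acts on it through the maps phi t. *)

Definition submodule (O : comNzRingType) (T : finType) (K : T -> fieldType)
    (phi : forall t, {rmorphism O -> K t}) (M : set (forall t, K t)) : Prop :=
  M (fun=> 0) /\
  forall a h g, M h -> M g -> M (fun t => phi t a * h t + g t).

(* M/N has length n as an O-module; its submodules are the X/N with X a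
   submodule between N and M. *)
Definition quotient_length (O : comNzRingType) (T : finType)
    (K : T -> fieldType) (phi : forall t, {rmorphism O -> K t})
    (M N : set (forall t, K t)) (n : nat) : Prop :=
  longest_chain [set X | [/\ submodule phi X, N `<=` X & X `<=` M]] n.

Definition fractional_ideal (O : comNzRingType) (T : finType)
    (K : T -> fieldType) (phi : forall t, {rmorphism O -> K t})
    (M : set (forall t, K t)) : Prop :=
  [/\ submodule phi M,
      (exists2 a : O, GRing.lreg a & M (fun t => phi t a)) &
      (exists2 d : O, GRing.lreg d &
         forall h, M h -> exists a, forall t, phi t d * h t = phi t a)].

Definition value_set (k : fieldType) (T : finType) (K : T -> fieldType)
    (tau : forall t, {rmorphism powser k -> K t}) (M : set (forall t, K t)) :
    set {ffun T -> int} :=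
  [set b | exists2 h, M h & forall t, val_eq (tau t) (h t) (b t)].

(* M(a), the elements of M of value at least a *)
Definition val_filtration (k : fieldType) (T : finType) (K : T -> fieldType)
    (tau : forall t, {rmorphism powser k -> K t}) (M : set (forall t, K t))
    (a : {ffun T -> int}) : set (forall t, K t) :=
  [set h | M h /\ forall t, val_ge (tau t) (h t) (a t)].

(** * Projections

   For J a set of branches, [idx J] is J as a type. *)

Definition idx (T : finType) (J : {set T}) : finType := {j : T | j \in J}.

Definition projK (T : finType) (K : T -> fieldType) (J : {set T})
    (M : set (forall t, K t)) : set (forall j : idx J, K (val j)) :=
  [set (fun j : idx J => h (val j)) | h in M].
Arguments projK {T K} J M _.

Definition pr (T : finType) (J : {set T}) (b : {ffun T -> int}) :
    {ffun idx J -> int} := [ffun j => b (val j)].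

(* pr_i(A) for A a subset of Z^J; it is empty unless i \in J. *)
Definition pr_image (T : finType) (J : {set T}) (i : T)
    (A : set {ffun idx J -> int}) : set int :=
  [set x | exists2 b, A b & exists2 j, val j = i & x = b j].

(** * Combinatorics of subsets of Z^T *)

Definition le_vec (T : finType) (b d : {ffun T -> int}) : Prop :=
  forall t, b t <= d t.

Definition is_min (T : finType) (E : set {ffun T -> int}) (m : {ffun T -> int})
    : Prop := E m /\ forall b, E b -> le_vec m b.

Definition is_conductor (T : finType) (E : set {ffun T -> int})
    (c : {ffun T -> int}) : Prop :=
  is_min [set g | E g /\ forall b, le_vec g b -> E b] c.

(* F_A(E, b) *)
Definition fiber (T : finType) (A : {set T}) (E : set {ffun T -> int})
    (b : {ffun T -> int}) : set {ffun T -> int} :=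
  [set d | E d /\
     forall t, if t \in A then d t = b t else b t < d t].

Definition maximals (T : finType) (E : set {ffun T -> int}) :
    set {ffun T -> int} :=
  [set b | E b /\ forall i, fiber [set i]%SET E b = set0].

Definition relative_maximals (T : finType) (E : set {ffun T -> int}) :
    set {ffun T -> int} :=
  [set b | maximals E b /\
     forall A : {set T}, (2 <= #|A|)%N -> fiber A E b !=set0].

(* Integers x > min S that do not lie in S *)
Definition gaps (S : set int) : set int :=
  [set x | ~ S x /\
     exists m, [/\ S m, (forall y, S y -> m <= y) & m < x]].

(* Main.v *)
Require Import Defs.
From HB Require Import structures.
From mathcomp Require Import all_boot all_order all_algebra.
From mathcomp Require Import mxpoly.
From mathcomp Require Import boolp classical_sets cardinality.
From mathcomp Require Import zify.

Set Implicit Arguments.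
Unset Strict Implicit.
Unset Printing Implicit Defensive.

Import Order.TTheory GRing.Theory Num.Theory.
Local Open Scope classical_set_scope.
Local Open Scope ring_scope.

(** Write r for the last branch, I for the ideal, I(a) for its elements of value
    at least a, and E for its value set.

    Length. Every element of I has value at least alpha0, so the elements of I
    whose projection to the other branches has value at least pr(gamma)
    form I(a), where a agrees with gamma except that a_r = alpha0_r. Hence
    I / I(a) has the same length as the quotient of the projection (lemma
    [series_pullback]). From I(a) down to I(gamma) the bound rises by one on the
    branch r at each step; a step from x to x + 1 has length 1 or 0, because the
    residue field is k and two elements of the same value cancel up to a
    constant ([series_upd]). It has length 1 exactly when x is reached: some
    theta in E has theta_r = x and theta_t >= gamma_t for all t <> r. So the
    difference of the two lengths is gamma_r - alpha0_r minus the number of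
    unreached x in [alpha0_r, gamma_r[.

    Unreached values. These are the gaps of E_r, and the x in E_r that are not
    reached. The second kind are exactly the last coordinates of the relative
    maximals of the E_J. This rests on E being closed under minima
    ([value_set_min]), on its exchange property ([value_set_exchange]), and on
    E_J = pr_J(E) ([value_set_proj]).

    If x is reached, exchanges with elements above the conductor make the
    coordinates t <> r of theta as large as desired ([raise_above]), and such an
    element over x contradicts the maximality of any beta in E_J with
    beta_r = x ([relative_maximal_unreached]).

    If x in E_r is not reached, take a vector b with b_r = x that is minimal
    among those bounded below by alpha0 - 1 that no theta in E over x exceeds in
    all coordinates t <> r. Let J consist of r and of the j with
    b_j >= alpha0_j; the other coordinates impose no condition. Lowering b_j for
    such a j gives, by minimality, an element of E that equals b exactly at r
    and j and exceeds it elsewhere. Minima and exchanges of these elements fill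
    the fibers of all A included in J with #A >= 2, while the fiber of {r}
    is empty by the choice of b, and those of the other singletons are empty
    because an exchange would fill the fiber of {r}: so pr_J(b) is a relative
    maximal of E_J ([relative_maximal_over]). *)

(** * Power series *)

Lemma psXM (k : comNzRingType) (s : powser k) n :
  (psX k * s) n = if n is m.+1 then s m else 0.
Proof.
change ((psX k * s) n) with (psmul (psX k) s n); rewrite /psmul big_ord_recl.
rewrite mul0r add0r; case: n => [|n]; first by rewrite big_ord0.
rewrite big_ord_recl mul1r big1 ?addr0; first by rewrite subn1.
by move=> i _; rewrite mul0r.
Qed.

Lemma psXnM (k : comNzRingType) (s : powser k) m n :
  (psX k ^+ m * s) n = if (n < m)%N then 0 else s (n - m)%N.
Proof.
elim: m n => [|m IHm] n; first by rewrite expr0 mul1r subn0.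
by rewrite exprS -mulrA psXM; case: n => [|n]; rewrite ?IHm.
Qed.

Lemma powser_unit (k : fieldType) (u : powser k) :
  u 0%N != 0 -> exists w : powser k, u * w = 1.
Proof.
move=> u0.
(* [L n] lists the first n coefficients of the inverse. *)
pose next n (l : seq k) :=
  ((n == 0%N)%:R - \sum_(i < n) u i.+1 * l`_(n - i.+1)) / u 0%N.
pose L := fix L n := if n is m.+1 then rcons (L m) (next m (L m)) else [::].
have sizeL n : size (L n) = n by elim: n => //= n IHn; rewrite size_rcons IHn.
pose w : powser k := fun n => next n (L n).
have LE n i : (i < n)%N -> (L n)`_i = w i.
  elim: n => // n IHn; rewrite ltnS leq_eqVlt /= nth_rcons sizeL => /predU1P[->|lt].
    by rewrite ltnn eqxx.
  by rewrite lt IHn.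
exists w; apply/funext => n.
change (psmul u w n = psC 1 n); rewrite /psmul big_ord_recl subn0.
rewrite [w n]/w /next mulrC divfK//.
rewrite (eq_bigr (fun i : 'I_n => u (lift ord0 i) * w (n - lift ord0 i)%N)).
  by rewrite subrK /psC; case: (n == 0%N).
by move=> i _; rewrite LE// ltn_subrL; case: n i => // -[].
Qed.

(** The order of a nonzero series: its first nonzero coefficient splits off a
    power of t. *)
Lemma powser_split (k : fieldType) (s : powser k) :
  s = 0 \/ exists n (u : powser k), u 0%N != 0 /\ s = psX k ^+ n * u.
Proof.
have [s0|/existsNP[m sm]] := pselect (forall n, s n = 0).
  by left; apply/funext.
right; have exn : exists n, s n != 0 by exists m; apply/eqP.
case: (ex_minnP exn) => n sn min_n.
exists n, (fun i => s (i + n)%N); split=> //.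
apply/funext => i; rewrite psXnM; case: ltnP => [lt|le]; last by rewrite subnK.
by apply: contraTeq lt => /min_n; rewrite -leqNgt.
Qed.

(** * The valuation of a branch *)

Section Valuation.

Variables (k K : fieldType) (tau : {rmorphism powser k -> K}).
Hypothesis tau_inj : injective tau.

Lemma uniformizer_neq0 : tau (psX k) != 0.
Proof.
apply/eqP; rewrite -(rmorph0 tau) => /tau_inj /(congr1 (@^~ 1%N)).
by apply/eqP/oner_neq0.
Qed.
Let X0 := uniformizer_neq0.

(** In this form, closure of the values at least a under sums and under
    multiplication by power series is a computation with series. *)
Lemma val_geP x a :
  val_ge tau x a <-> exists s, x = tau (psX k) ^ a * tau s.
Proof.
split=> [[->|[n le_an [u _ ->]]]|[s ->]]; first by exists 0; rewrite rmorph0 mulr0.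
  exists (psX k ^+ `|n - a|%N * u).
  rewrite rmorphM rmorphXn mulrA exprnP -expfzDr//.
  by rewrite gez0_abs ?subr_ge0// subrKC.
have [->|[n [u [u0 ->]]]] := powser_split s; first by left; rewrite rmorph0 mulr0.
right; exists (a + n%:Z); first by rewrite lerDl.
by exists u => //; rewrite rmorphM rmorphXn mulrA exprnP expfzDr.
Qed.

Lemma val_geW x a b : b <= a -> val_ge tau x a -> val_ge tau x b.
Proof.
by move=> le_ba [->|[n le_an xn]]; [left | right; exists n => //; apply: le_trans le_an].
Qed.

Lemma val_eq_ge x a b : b <= a -> val_eq tau x a -> val_ge tau x b.
Proof. by move=> le_ba xa; right; exists a. Qed.

Lemma val_geD x y a :
  val_ge tau x a -> val_ge tau y a -> val_ge tau (x + y) a.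
Proof.
move=> /val_geP[s ->] /val_geP[s' ->]; apply/val_geP.
by exists (s + s'); rewrite rmorphD mulrDr.
Qed.

Lemma val_geM s x a : val_ge tau x a -> val_ge tau (tau s * x) a.
Proof.
move=> /val_geP[s' ->]; apply/val_geP; exists (s * s').
by rewrite rmorphM mulrCA.
Qed.

Lemma val_eq_geF x a b : val_eq tau x a -> val_ge tau x b -> b <= a.
Proof.
move=> [u u0 ->] /val_geP[s e]; rewrite leNgt; apply/negP => lt_ab.
have {}e : tau u = tau (psX k ^+ `|b - a|%N * s).
  apply: (mulfI (expfz_neq0 a X0)); rewrite e rmorphM rmorphXn mulrA exprnP.
  by rewrite -expfzDr// gez0_abs ?subr_ge0 ?(ltW lt_ab)// subrKC.
move/tau_inj: e => eu; move: u0; rewrite eu psXnM ifT ?eqxx//.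
by rewrite absz_gt0 subr_eq0 gt_eqF.
Qed.

Lemma val_eq_uniq x a b : val_eq tau x a -> val_eq tau x b -> a = b.
Proof.
move=> xa xb; apply/le_anti.
by rewrite (val_eq_geF xa (val_eq_ge _ xb))// (val_eq_geF xb (val_eq_ge _ xa)).
Qed.

Lemma val_eq_neq0 x a : val_eq tau x a -> x != 0.
Proof.
move=> xa; apply/eqP => x0.
have /(val_eq_geF xa) : val_ge tau x (a + 1) by left.
by rewrite gerDl.
Qed.

Lemma val_ge_eq x a : val_ge tau x a -> ~ val_ge tau x (a + 1) -> val_eq tau x a.
Proof.
move=> [->|[n le_an xn]] nge; first by case: nge; left.
have [<-//|ne] := eqVneq n a.
by case: nge; right; exists n => //; rewrite lezD1 lt_neqAle eq_sym ne.
Qed.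

(** The coefficient of t^a in [c * x + y] is affine in c, so at most one c
    makes it vanish; [val_cancel] uses that c, the others keep the value. *)
Lemma val_eq_generic x y a :
  val_ge tau x a -> val_ge tau y a -> val_eq tau x a \/ val_eq tau y a ->
  exists bad, forall c, c != bad -> val_eq tau (tau (psC c) * x + y) a.
Proof.
have coef_unit s : val_eq tau (tau (psX k) ^ a * tau s) a -> s 0%N != 0.
  by case=> u u0 /(mulfI (expfz_neq0 a X0)) /tau_inj ->.
move=> /val_geP[s ->] /val_geP[s' ->] st.
exists (- s' 0%N / s 0%N) => c ne.
exists (psC c * s + s'); last by rewrite rmorphD rmorphM mulrDr mulrCA.
change (psmul (psC c) s 0%N + s' 0%N != 0).
rewrite /psmul big_ord_recl big_ord0 addr0 subn0 /psC /=.
have [s0|s0] := eqVneq (s 0%N) 0.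
  by rewrite s0 mulr0 add0r; case: st => /coef_unit//; rewrite s0 eqxx.
by apply: contra_neq ne => /eqP; rewrite addr_eq0 => /eqP<-; rewrite mulfK.
Qed.

Lemma val_cancel x y a : val_eq tau x a -> val_eq tau y a ->
  exists2 c, c != 0 & val_ge tau (tau (psC c) * x + y) (a + 1).
Proof.
move=> [u u0 ->] [w w0 ->]; exists (- w 0%N / u 0%N).
  by rewrite mulf_neq0 ?invr_eq0 ?oppr_eq0.
apply/val_geP; set c := (X in psC X); pose s := psC c * u + w.
have s0 : s 0%N = 0.
  change (psmul (psC c) u 0%N + w 0%N = 0).
  by rewrite /psmul big_ord_recl big_ord0 addr0 subn0 /psC /= divfK// addNr.
exists (fun n => s n.+1); rewrite mulrCA -mulrDr -rmorphM -rmorphD -/s.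
rewrite expfzDr// expr1z -mulrA -rmorphM; congr (_ * tau _).
by apply/funext => -[|n]; rewrite psXM.
Qed.

Lemma val_eqD x y a :
  val_eq tau x a -> val_ge tau y (a + 1) -> val_eq tau (x + y) a.
Proof.
move=> xa ya; have ya' : val_ge tau y a by apply: val_geW ya; rewrite lerDl.
apply: val_ge_eq; first exact: val_geD (val_eq_ge _ xa) ya'.
move=> xya; have := val_geD xya (val_geM (-1) ya).
rewrite rmorphN1 mulN1r addrK => /(val_eq_geF xa).
by rewrite gerDl.
Qed.

Lemma val_eqZ c x a : c != 0 -> val_eq tau x a -> val_eq tau (tau (psC c) * x) a.
Proof.
move=> c0 [u u0 ->]; exists (psC c * u); last by rewrite rmorphM mulrCA.
change (psmul (psC c) u 0%N != 0).
by rewrite /psmul big_ord_recl big_ord0 addr0 subn0 mulf_neq0.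
Qed.

End Valuation.

(** An algebraically closed field is infinite. *)
Lemma closed_field_avoid (k : closedFieldType) (s : seq k) :
  exists c, c \notin s.
Proof.
have /closed_nonrootP[c] : \prod_(a <- s) ('X - a%:P) != 0.
  by apply: monic_neq0; apply: monic_prod_XsubC.
by rewrite root_prod_XsubC => cs; exists c.
Qed.

(** * Composition series *)

Section CompositionSeries.

Variables (O : comNzRingType) (T : finType) (K : T -> fieldType).
Variable phi : forall t, {rmorphism O -> K t}.
Implicit Types M N L X Y : set (forall t, K t).

Lemma submoduleI M N :
  submodule phi M -> submodule phi N -> submodule phi (M `&` N).
Proof.
move=> [M0 Mc] [N0 Nc]; split=> // a h g [Mh Nh] [Mg Ng].
by split; [apply: Mc | apply: Nc].
Qed.

Definition simple_quotient M N : Prop :=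
  [/\ submodule phi M, N `<` M &
      forall h g, M h -> ~ N h -> M g -> exists a, N (fun t => phi t a * h t + g t)].

(** The bottom N is fixed and factors are added at the top, so that an induction
    on the series can intersect a submodule with the next term below. *)
Inductive series N : set (forall t, K t) -> nat -> Prop :=
| series_nil : submodule phi N -> series N N 0
| series_cons M L d : simple_quotient L M -> series N M d -> series N L d.+1.

Lemma series_sub N M d : series N M d -> N `<=` M.
Proof.
by elim=> [_ //|{}M L {}d [_ [ML _] _] _ NM]; apply: subset_trans ML.
Qed.

Lemma series_top N M d : series N M d -> submodule phi M.
Proof. by case=> // {}M L {}d []. Qed.

Lemma series_cat N M L d e : series N M d -> series M L e -> series N L (e + d).
Proof. by move=> NM; elim=> // M' L' {}e s _; apply: series_cons. Qed.

(** This is the inequality of Jordan and Hoelder. The height counts the factors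
    of the series that X meets nontrivially; two nested submodules that meet the
    same factors agree, factor after factor, because each factor is generated by
    any nonzero element. *)
Lemma series_height N M d : series N M d ->
  exists2 ht : set (forall t, K t) -> nat, (ht M <= d)%N &
    forall X Y, submodule phi X -> submodule phi Y ->
      N `<=` X -> X `<=` Y -> Y `<=` M ->
    (ht X <= ht Y)%N /\ (ht X = ht Y -> Y `<=` X).
Proof.
elim=> [subN|{}M L {}d [subL [ML nLM] sLM] sM [ht htM htP]].
  by exists (fun=> 0%N) => // X Y _ _ NX _ YN; split=> // _; apply: subset_trans NX.
exists (fun X => ht (X `&` M) + `[< ~ (X `<=` M) >])%N.
  have -> : L `&` M = M by apply/seteqP; split=> [h []//|h Mh]; split=> //; apply: ML.
  by rewrite -addn1 leq_add// leq_b1.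
move=> X Y subX subY NX XY YL.
have subM := series_top sM.
have [|||leXY eqXY] := htP _ _ (submoduleI subX subM) (submoduleI subY subM).
- by move=> h Nh; split; [apply: NX | apply: (series_sub sM)].
- by move=> h [Xh Mh]; split=> //; apply: XY.
- by move=> h [].
have leb : (`[< ~ (X `<=` M) >] <= `[< ~ (Y `<=` M) >])%N.
  case: asboolP => // nXM; case: asboolP => //; case=> YM; apply: nXM.
  exact: subset_trans YM.
split=> [|e]; first exact: leq_add.
have {}eqXY := eqXY ltac:(lia); have {}e : `[< ~ (X `<=` M) >] = `[< ~ (Y `<=` M) >].
  by move: e leb leXY; do 2 case: asboolP => _ //=; lia.
have [/nonsubset[g [Xg nMg]] h Yh|nnXM] := pselect (~ (X `<=` M)).
  have [a Mag] := sLM g h (YL _ (XY _ Xg)) nMg (YL _ Yh).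
  have [Xag _] : (X `&` M) (fun t => phi t a * g t + h t).
    by apply: eqXY; split=> //; apply: (subY.2) => //; apply: XY.
  have -> : h = fun t => phi t (- a) * g t + (phi t a * g t + h t).
    by apply: functional_extensionality_dep => t; rewrite rmorphN mulNr addKr.
  exact: subX.2.
have /contrapT YM : ~ ~ (Y `<=` M) by apply/asboolPn; rewrite -e; apply/asboolPn.
by move=> h Yh; have [] : (X `&` M) h by apply: eqXY; split=> //; apply: YM.
Qed.

Lemma series_length N M d : series N M d -> quotient_length phi M N d.
Proof.
move=> s; split.
  elim: s => [subN|{}M L {}d [subL ML sLM] sM [X [XP Xlt]]].
    by exists (fun=> N); split=> // i _; split.
  have lastX : X d `<=` M by case: (XP d (leqnn d)).
  exists (fun i => if (i <= d)%N then X i else L); split=> i.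
    case: (leqP i d) => [id _|_ _]; last first.
      by split=> //; apply: subset_trans (ML.1); apply: series_sub sM.
    by have [? ? XM] := XP i id; split=> //; apply: subset_trans ML.1.
  rewrite ltnS => le_id; rewrite le_id.
  have [id|lt_di|->] := ltngtP i d; [exact: Xlt | lia |].
  split; first exact: subset_trans ML.1.
  by move=> LX; apply: ML.2; apply: subset_trans lastX.
move=> m X [XP Xlt]; have [ht htM htP] := series_height s.
suff le_ht i : (i <= m)%N -> (i <= ht (X i))%N.
  apply: leq_trans (le_ht m (leqnn m)) (leq_trans _ htM).
  have [subX NX XM] := XP m (leqnn m).
  by have [] := htP _ _ subX (series_top s) NX XM (@subset_refl _ M).
elim: i => // i IHi lt_im; apply: leq_ltn_trans (IHi (ltnW lt_im)) _.
have [subX NX XM] := XP i (ltnW lt_im); have [subY NY YM] := XP _ lt_im.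
have [XY nYX] := Xlt i lt_im.
have [le_ht eq_ht] := htP _ _ subX subY NX XY YM.
by rewrite ltn_neqAle le_ht andbT; apply/eqP => /eq_ht.
Qed.

End CompositionSeries.

(** The projection of M is the quotient of M by the elements that vanish on the
    branches in J, so taking preimages keeps the factors. *)
Lemma series_pullback (O : comNzRingType) (T : finType) (K : T -> fieldType)
    (phi : forall t, {rmorphism O -> K t}) (J : {set T}) (M : set (forall t, K t))
    (N L : set (forall j : idx J, K (val j))) d :
  submodule phi M -> L `<=` projK J M ->
  series (fun j : idx J => phi (val j)) N L d ->
  series phi [set h | M h /\ N (fun j => h (val j))]
    [set h | M h /\ L (fun j => h (val j))] d.
Proof.
move=> subM + s.
have sub_pb (X : set (forall j : idx J, K (val j))) :
    submodule (fun j : idx J => phi (val j)) X ->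
    submodule phi [set h | M h /\ X (fun j => h (val j))].
  move=> [X0 Xc]; split=> [|a h g [Mh Xh] [Mg Xg]]; first by split=> //; case: subM.
  by split; [apply: subM.2 | apply: (Xc a _ _ Xh Xg)].
elim: s => [subN _|{L d}L' L d [subL [L'L nLL'] sL] sL' IH LM].
  exact/series_nil/sub_pb.
apply: series_cons (IH (subset_trans L'L LM)); split; first exact: sub_pb.
- split=> [h [Mh /L'L]//|sub]; apply: nLL' => g Lg.
  have [h Mh hg] := LM g Lg.
  by rewrite -hg; apply: (sub h _).2; split; rewrite // hg.
- move=> h g [Mh Lh] nLh [Mg Lg].
  have nLh' : ~ L' (fun j => h (val j)) by move=> L'h; apply: nLh.
  have [a La] := sL _ _ Lh nLh' Lg.
  by exists a; split=> //; apply: subM.2.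
Qed.

(** * Value filtrations and value sets *)

(** What the length formula retains of the normalization of the branches. It
    passes to any subfamily of branches, hence applies both to the curve and to
    its projections. *)
Definition parametrized (k : closedFieldType) (O : comUnitAlgType k)
    (T : finType) (K : T -> fieldType) (phi : forall t, {rmorphism O -> K t})
    (tau : forall t, {rmorphism powser k -> K t}) : Prop :=
  forall t, [/\ injective (tau t), (forall a, exists s, phi t a = tau t s),
    (forall c, tau t (psC c) = phi t c%:A) &
    (forall x, x != 0 -> exists n, val_eq (tau t) x n)].

Lemma branch_parametrized (k : closedFieldType) (O : comUnitAlgType k)
    (T : finType) (P : T -> set O) (K : T -> fieldType)
    (phi : forall t, {rmorphism O -> K t})
    (tau : forall t, {rmorphism powser k -> K t}) :
  (forall t, branch (P t) (phi t) (tau t)) -> parametrized phi tau.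
Proof.
move=> br t; have [_ frac inj_tau int_tau tauC] := br t.
have phi_tau a : exists s, phi t a = tau t s.
  by have /int_tau[s <-] := integral_id (phi t) a; exists s.
split=> // x x0; have [a [b [b0 xE]]] := frac x.
have [[s sE] [s' s'E]] := (phi_tau a, phi_tau b).
have [s0|[m [u [u0 su]]]] := powser_split s.
  by move: x0; rewrite xE sE s0 rmorph0 mul0r eqxx.
have [s0|[n [w [w0 sw]]]] := powser_split s'.
  by move: b0; rewrite s'E s0 rmorph0 eqxx.
have [v wv] := powser_unit w0.
have v0 : v 0%N != 0.
  apply/eqP => v0; have /eqP : (w * v) 0%N = 0.
    by change (psmul w v 0%N = 0); rewrite /psmul big_ord_recl big_ord0 v0 mulr0 add0r.
  by rewrite wv; apply/negP/oner_neq0.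
exists (m%:Z - n%:Z), (u * v).
  change (psmul u v 0%N != 0).
  by rewrite /psmul big_ord_recl big_ord0 addr0 mulf_neq0.
have X0 := uniformizer_neq0 inj_tau.
have tw0 : tau t w != 0 by rewrite -(rmorph0 (tau t)) (inj_eq inj_tau); apply: contraNneq w0 => ->.
rewrite xE sE s'E su sw !rmorphM !rmorphXn expfzDr// -invr_expz -!exprnP.
have -> : tau t v = (tau t w)^-1.
  by apply: (mulfI tw0); rewrite mulfV// -rmorphM wv rmorph1.
by rewrite invfM !mulrA; congr (_ * _); rewrite mulrAC.
Qed.

Definition upd (T : finType) (b : {ffun T -> int}) (i : T) (x : int) :
    {ffun T -> int} := [ffun t => if t == i then x else b t].

Section Values.

Variables (k : closedFieldType) (O : comUnitAlgType k) (T : finType).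
Variables (K : T -> fieldType) (phi : forall t, {rmorphism O -> K t}).
Variable tau : forall t, {rmorphism powser k -> K t}.
Hypothesis par : parametrized phi tau.
Variable M : set (forall t, K t).
Hypothesis subM : submodule phi M.

Let tau_inj t : injective (tau t). Proof. by case: (par t). Qed.
Let tauC t c : tau t (psC c) = phi t c%:A. Proof. by case: (par t). Qed.
Let val_exists t x : x != 0 -> exists n, val_eq (tau t) x n.
Proof. by case: (par t) => _ _ _; apply. Qed.

Local Notation filt := (val_filtration tau M).

Lemma val_ge_act t a x n : val_ge (tau t) x n -> val_ge (tau t) (phi t a * x) n.
Proof. by case: (par t) => _ /(_ a)[s ->] _ _; apply: val_geM. Qed.

Lemma val_filtration_submodule a : submodule phi (filt a).
Proof.
split=> [|b h g [Mh ha] [Mg ga]]; first by split; [case: subM | left].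
by split=> [|t]; [apply: subM.2 | apply: (val_geD (@tau_inj t)) => //; apply: val_ge_act].
Qed.

Lemma val_filtrationS a b : le_vec a b -> filt b `<=` filt a.
Proof. by move=> ab h [Mh hb]; split=> // t; apply: val_geW (hb t). Qed.

(** Raising the bound by one on a single branch cuts out at most one dimension:
    two elements of exact value x there cancel up to a constant. *)
Lemma series_upd N a j d :
  series phi N (filt (upd a j (a j + 1))) d ->
  series phi N (filt a)
    (`[< exists2 h, filt a h & val_eq (tau j) (h j) (a j) >] + d)%N.
Proof.
set a' := upd _ _ _ => s.
have le_aa' : le_vec a a'.
  by move=> t; rewrite ffunE; case: eqP => // ->; rewrite lerDl.
have a'P h : filt a h -> (val_ge (tau j) (h j) (a j + 1)) -> filt a' h.
  by move=> [Mh ha] hj; split=> // t; rewrite ffunE; case: eqP => // ->.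
case: asboolP => [[h ah hj]|nh]; last first.
  rewrite add0n (_ : filt a = filt a')//.
  apply/seteqP; split; last exact: val_filtrationS.
  move=> h ah; apply: (a'P _ ah); apply: contrapT => nhj; apply: nh; exists h => //.
  by apply: val_ge_eq nhj; case: ah.
apply: series_cons s; split.
- exact: val_filtration_submodule.
- split; first exact: val_filtrationS.
  move=> /(_ h ah)[_ /(_ j)]; rewrite ffunE eqxx => /(val_eq_geF (@tau_inj j) hj).
  by rewrite gerDl.
- move=> f g af nf ag.
  have fj : val_eq (tau j) (f j) (a j).
    by apply: val_ge_eq => [|fj]; [case: af | apply: nf; apply: a'P].
  have [gj|gj] := pselect (val_ge (tau j) (g j) (a j + 1)).
    exists 0; rewrite (_ : (fun t => _) = g); first exact: a'P.
    by apply: functional_extensionality_dep => t; rewrite rmorph0 mul0r add0r.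
  have {}gj : val_eq (tau j) (g j) (a j) by apply: val_ge_eq gj; case: ag.
  have [c _ cfg] := val_cancel (@tau_inj j) fj gj; exists c%:A; apply: a'P.
    exact: (val_filtration_submodule a).2.
  by rewrite -tauC.
Qed.

Lemma val_filtration_series a g : le_vec a g ->
  exists d, series phi (filt g) (filt a) d.
Proof.
have [N] := ubnP (\sum_t `|g t - a t|%N)%N; elim: N a => // N IHN a lt_N le_ag.
have [eq_ag|/existsNP[j /negP nej]] := pselect (forall t, a t == g t).
  rewrite (_ : a = g); last by apply/ffunP => t; apply/eqP.
  by exists 0%N; apply: series_nil; apply: val_filtration_submodule.
have lt_j : a j < g j by rewrite lt_neqAle nej le_ag.
have [||d s] := IHN (upd a j (a j + 1)).
- rewrite -ltnS; apply: leq_trans lt_N; rewrite ltnS (bigD1 j)//=.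
  rewrite [X in (_ < X)%N](bigD1 j)//= ffunE eqxx.
  rewrite -addSn leq_add//; first by lia.
  by apply: leq_sum => t /negPf tj; rewrite ffunE tj.
- by move=> t; rewrite ffunE; case: eqP => [->|_]; [rewrite lezD1 | apply: le_ag].
- by eexists; apply: series_upd s.
Qed.

(** Along a single branch j the factors that occur are those of the values
    taken on j, with the other values above g; they are listed downwards from
    g j. *)
Lemma val_filtration_series_branch g j N :
  series phi (filt g) (filt (upd g j (g j - N%:Z)))
    (count (fun i => `[< exists2 h, filt (upd g j (g j - i.+1%:Z)) h &
               val_eq (tau j) (h j) (g j - i.+1%:Z) >]) (iota 0 N)).
Proof.
elim: N => [|N IHN].
  rewrite (_ : upd _ _ _ = g); last first.
    by apply/ffunP => t; rewrite ffunE subr0; case: eqP => // ->.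
  exact/series_nil/val_filtration_submodule.
have -> : iota 0 N.+1 = iota 0 N ++ [:: N] by rewrite -addn1 iotaD.
rewrite count_cat /= addn0 addnC.
have updj x : upd g j x j = x by rewrite ffunE eqxx.
move: (@series_upd (filt g) (upd g j (g j - N.+1%:Z)) j).
rewrite updj; apply; rewrite (_ : upd _ _ _ = upd g j (g j - N%:Z))//.
by apply/ffunP => t; rewrite !ffunE; case: eqP => // _; lia.
Qed.

Local Notation E := (value_set tau M).
Variable c : {ffun T -> int}.
Hypothesis above_c : forall b, le_vec c b -> E b.

(** Adding an element of large value replaces the zero components of an element
    and keeps the values of its other components. *)
Lemma value_set_regularize h B : M h -> exists2 e, E e &
  forall t, (h t != 0 -> val_eq (tau t) (h t) (e t)) /\ (h t = 0 -> B t <= e t).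
Proof.
move=> Mh.
have /choice[m mP] t : exists m, h t != 0 -> val_eq (tau t) (h t) m.
  by have [->|/val_exists[m hm]] := eqVneq (h t) 0; [exists 0 | exists m].
pose N := [ffun t => Num.max (c t) (Num.max (B t) (m t + 1))].
have NP t : [/\ c t <= N t, B t <= N t & m t + 1 <= N t].
  by rewrite ffunE !le_max !lexx !orbT.
have [g Mg gN] : E N by apply: above_c => t; case: (NP t).
exists [ffun t => if h t == 0 then N t else m t].
  exists (fun t => phi t 1 * h t + g t); first exact: subM.2.
  move=> t; rewrite ffunE rmorph1 mul1r; case: eqVneq => [->|/mP hm].
    by rewrite add0r.
  by apply: (val_eqD (@tau_inj _)) => //; apply: val_eq_ge (gN t); case: (NP t).
move=> t; rewrite ffunE; split=> [/[dup] /mP ? /negPf->//|->].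
by rewrite eqxx; case: (NP t).
Qed.

Lemma value_set_proj J :
  value_set (fun j : idx J => tau (val j)) (projK J M) = @pr T J @` E.
Proof.
apply/seteqP; split=> [b [_ [h Mh <-] hb]|_ [b [h Mh hb] <-]]; last first.
  by exists (fun j => h (val j)); [exists h | move=> j; rewrite ffunE].
have [e Ee eP] := value_set_regularize c Mh; exists e => //.
apply/ffunP => j; rewrite ffunE; apply: (val_eq_uniq (@tau_inj _)) (hb j).
exact/(eP _).1/(val_eq_neq0 (@tau_inj _) (hb j)).
Qed.

(** The zero components of h are why this needs regularization: they give h no
    value of its own in E. *)
Lemma value_set_lower a h : (forall b, E b -> le_vec a b) -> M h -> filt a h.
Proof.
move=> Ea Mh; split=> // t; have [->|ht] := eqVneq (h t) 0; first by left.
have [e Ee eP] := value_set_regularize c Mh.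
exact: val_eq_ge (Ea _ Ee t) ((eP t).1 ht).
Qed.

(** A combination with a coefficient outside a finite set takes on every branch
    the smaller of the two values; the residue field is infinite. *)
Lemma value_set_min a b : E a -> E b -> E [ffun t => Num.min (a t) (b t)].
Proof.
move=> [h Mh ha] [g Mg gb].
have /choice[bad badP] t : exists bad, forall c, c != bad ->
    val_eq (tau t) (tau t (psC c) * h t + g t) (Num.min (a t) (b t)).
  apply: (val_eq_generic (@tau_inj t)).
  - by apply: val_eq_ge (ha t); rewrite ge_min lexx.
  - by apply: val_eq_ge (gb t); rewrite ge_min lexx orbT.
  - by case: leP => _; [left | right].
have [z zP] := closed_field_avoid [seq bad t | t : T].
exists (fun t => phi t z%:A * h t + g t); first exact: subM.2.
move=> t; rewrite ffunE -tauC; apply: badP; apply: contraNneq zP => ->.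
exact: fintype.image_f.
Qed.

(** The combination that cancels the leading terms on the branch i is made
    regular by a large element, which affects neither the bound by the minimum
    nor the components where the values differ. *)
Lemma value_set_exchange a b i : E a -> E b -> a i = b i ->
  exists2 e, E e & a i < e i /\ forall t, Num.min (a t) (b t) <= e t /\
                     (a t != b t -> e t = Num.min (a t) (b t)).
Proof.
move=> [h Mh ha] [g Mg gb] abi.
have gi : val_eq (tau i) (g i) (a i) by rewrite abi; apply: gb.
have [z z0 zi] := val_cancel (@tau_inj i) (ha i) gi.
pose f t := phi t z%:A * h t + g t.
have Mf : M f by apply: subM.2.
have fge t : val_ge (tau t) (f t) (Num.min (a t) (b t)).
  apply: (val_geD (@tau_inj t)).
    by apply: val_ge_act; apply: val_eq_ge (ha t); rewrite ge_min lexx.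
  by apply: val_eq_ge (gb t); rewrite ge_min lexx orbT.
have [e Ee eP] := value_set_regularize [ffun t => Num.max (a t) (b t) + 1] Mf.
have ge_e t x : x <= Num.max (a t) (b t) + 1 -> val_ge (tau t) (f t) x -> x <= e t.
  move=> le_x fx; have [/(eP t).2|/(eP t).1 fe] := eqVneq (f t) 0.
    by rewrite ffunE; apply: le_trans.
  exact: val_eq_geF (@tau_inj t) _ _ _ fe fx.
exists e => //; split.
  by rewrite -lezD1; apply: ge_e; rewrite ?lerD2r ?le_max ?lexx// /f -tauC.
move=> t; split; first by apply: ge_e => //; lia.
have fE x : val_eq (tau t) (f t) x -> e t = x.
  move=> fx; apply: (val_eq_uniq (@tau_inj t) _ fx).
  exact/(eP t).1/(val_eq_neq0 (@tau_inj t) fx).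
have hz : val_eq (tau t) (phi t z%:A * h t) (a t) by rewrite -tauC; apply: val_eqZ.
case: ltgtP => // lt_ab _; apply: fE.
  by apply: (val_eqD (@tau_inj _)) => //; apply: val_eq_ge (gb t); rewrite lezD1.
by rewrite /f addrC; apply: (val_eqD (@tau_inj _)) => //; apply: val_eq_ge hz; rewrite lezD1.
Qed.

End Values.

(** * Relative maximals *)

Section RelativeMaximals.

Variables (T : finType) (E : set {ffun T -> int}).
Hypothesis E_min : forall a b, E a -> E b -> E [ffun t => Num.min (a t) (b t)].
Hypothesis E_exchange : forall a b i, E a -> E b -> a i = b i ->
  exists2 e, E e & a i < e i /\ forall t, Num.min (a t) (b t) <= e t /\
                     (a t != b t -> e t = Num.min (a t) (b t)).

(** The minimum of two elements equals b where one of them does. *)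
Lemma fiberU (A B : {set T}) b :
  fiber A E b !=set0 -> fiber B E b !=set0 -> fiber (A :|: B) E b !=set0.
Proof.
move=> [d [Ed dA]] [e [Ee eB]]; eexists; split; first exact: E_min Ed Ee.
move=> t; have := dA t; have := eB t; rewrite inE ffunE.
by case: (t \in A); case: (t \in B) => /=; lia.
Qed.

(** Away from i, the two elements differ on A and on B, where one equals b and
    the other exceeds it; there an exchange at i takes the minimum. *)
Lemma fiber_exchange (A B : {set T}) i b : A :&: B = [set i]%SET ->
  fiber A E b !=set0 -> fiber B E b !=set0 -> fiber ((A :|: B) :\ i) E b !=set0.
Proof.
move=> ABi [d [Ed dA]] [e [Ee eB]].
have iAB t : (t \in A) && (t \in B) = (t == i) by have /setP/(_ t) := ABi; rewrite !inE.
have /andP[iA iB] : (i \in A) && (i \in B) by rewrite iAB.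
have [|f Ef [fi ft]] := E_exchange (i := i) Ed Ee.
  by have := dA i; have := eB i; rewrite iA iB => -> ->.
exists f; split=> // t; rewrite !inE; have [->|ti] := eqVneq t i.
  by have := dA i; rewrite iA /= => <-.
have := dA t; have := eB t; have := iAB t; have [] := ft t; rewrite (negPf ti).
by case: (t \in A); case: (t \in B) => //=; lia.
Qed.

(** A coordinate of b that is below all of E imposes no condition on a fiber in
    which it is to be exceeded, and can be projected away. *)
Lemma fiber_pr (J : {set T}) (A : {set idx J}) (b : {ffun T -> int}) :
  (forall t, t \notin J -> forall d, E d -> b t < d t) ->
  fiber A (@pr T J @` E) (pr J b) !=set0 <-> fiber (val @: A) E b !=set0.
Proof.
move=> bJ; split=> [[_ [[d Ed <-] dA]]|[d [Ed dA]]]; last first.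
  exists (pr J d); split=> [|j]; first by exists d.
  by have := dA (val j); rewrite !ffunE (mem_imset _ _ val_inj).
exists d; split=> // t; have [tJ|tJ] := boolP (t \in J); last first.
  rewrite ifN; first exact: bJ.
  by apply: contra tJ => /imsetP[j _ ->]; apply: valP.
by have := dA (Sub t tJ); rewrite !ffunE -(mem_imset _ _ val_inj) SubK.
Qed.

Variables (r : T) (x : int) (lo g : {ffun T -> int}).
Hypothesis E_ge_lo : forall d, E d -> le_vec lo d.

(* The bound [lo t - 1] is exceeded by all of E: it stands for no condition at
   t, and makes minimal vectors exist. *)
Let unexceeded (b : {ffun T -> int}) : Prop :=
  [/\ b r = x, (forall t, t != r -> lo t - 1 <= b t) &
      forall d, E d -> d r = x -> ~ (forall t, t != r -> b t < d t)].

Lemma minimal_unexceeded b : unexceeded b ->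
  exists2 m, unexceeded m &
    forall j, j != r -> lo j <= m j -> ~ unexceeded (upd m j (m j - 1)).
Proof.
have [N] := ubnP (\sum_t `|b t - (lo t - 1)%R|)%N.
elim: N b => // N IHN b lt_N ub.
have [min_b|/existsNP[j /not_implyP[jr /not_implyP[lo_b /contrapT ubj]]]] :=
  pselect (forall j, j != r -> lo j <= b j -> ~ unexceeded (upd b j (b j - 1))).
  by exists b.
apply: IHN ubj; rewrite -ltnS; apply: leq_trans lt_N.
rewrite ltnS (bigD1 j)//= [X in (_ < X)%N](bigD1 j)//= ffunE eqxx.
rewrite -addSn leq_add//; first by lia.
by apply: leq_sum => t /negPf tj; rewrite ffunE tj.
Qed.

(** A minimal unexceeded vector b is a relative maximal, on the coordinates
    where it is not below E: minimality fills the fiber of each pair of r and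
    another coordinate of J ([pairJ]), and all the other fibers follow by minima
    and exchanges. *)
Lemma relative_maximal_over :
  (exists2 d, E d & d r = x) ->
  ~ (exists2 d, E d & d r = x /\ forall t, t != r -> g t <= d t) ->
  exists2 J : {set T}, r \in J /\ J <> [set r]%SET &
    pr_image r (relative_maximals (@pr T J @` E)) x.
Proof.
move=> [d0 Ed0 d0r] nreach.
have [|b [br blo bE] bmin] :=
    @minimal_unexceeded [ffun t => if t == r then x else Num.max (lo t) (g t) - 1].
  split=> [|t /negPf tr|d Ed dr lt_d]; rewrite ?ffunE ?eqxx ?tr; [done | lia |].
  apply: nreach; exists d => //; split=> // t tr.
  by have := lt_d t tr; rewrite ffunE (negPf tr); lia.
pose J := [set j | (j == r) || (lo j <= b j)]%SET.
have bJ t : t \notin J -> forall d, E d -> b t < d t.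
  rewrite inE negb_or -ltNge => /andP[tr lt_b] d /E_ge_lo /(_ t).
  exact: lt_le_trans.
have rJ : r \in J by rewrite inE eqxx.
have pairJ j : j \in J -> j != r -> fiber [set j; r]%SET E b !=set0.
  rewrite inE => /orP[/eqP->|lo_b jr]; first by rewrite eqxx.
  have [d [Ed dr lt_d]] : exists d,
      [/\ E d, d r = x & forall t, t != r -> upd b j (b j - 1) t < d t].
    apply: contrapT => nd; apply: (bmin j jr lo_b); split.
    - by rewrite ffunE eq_sym (negPf jr).
    - move=> t tr; rewrite ffunE; case: eqP => [->|_]; [lia | exact: blo].
    - by move=> d Ed dr lt_d; apply: nd; exists d.
  have dj : d j = b j.
    apply: le_anti; have := lt_d j jr; rewrite ffunE eqxx => lt_dj.
    rewrite andbC; apply/andP; split; first by lia.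
    rewrite leNgt; apply/negP => lt_bd; apply: (bE d Ed dr) => t tr.
    by have := lt_d t tr; rewrite ffunE; case: eqP => [->|].
  exists d; split=> // t; rewrite !inE; have [->//|tj] := eqVneq t j.
  have [->|tr] := eqVneq t r; first by rewrite dr br.
  by have := lt_d t tr; rewrite ffunE (negPf tj).
have fib0 : fiber [set r]%SET E b = set0.
  rewrite -subset0 => d [Ed dP]; apply: (bE d Ed).
    by have := dP r; rewrite inE eqxx br.
  by move=> t tr; have := dP t; rewrite inE (negPf tr).
have fib1 i : i \in J -> fiber [set i]%SET E b = set0.
  have [->//|ir iJ] := eqVneq i r; apply: contrapT => /eqP/set0P fi.
  (* an exchange at i with the element of [pairJ] would exceed b over x *)
  suff : fiber [set r]%SET E b !=set0 by rewrite fib0 => -[].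
  rewrite (_ : [set r]%SET = ([set i] :|: [set i; r]) :\ i); last first.
    by apply/setP => t; rewrite !inE; case: (eqVneq t i) => [->|]; rewrite ?(negPf ir).
  apply: fiber_exchange fi (pairJ i iJ ir).
  by apply/setP => t; rewrite !inE; case: (t =P i).
have fibr (A : {set T}) : A \subset J -> (exists2 j, j \in A & j != r) ->
    fiber (r |: A) E b !=set0.
  have [N] := ubnP #|A|; elim: N A => // N IHN A; rewrite ltnS => leAN AJ [j jA jr].
  have [[i iA ir]|no] := pselect (exists2 i, i \in A :\ j & i != r).
    rewrite (_ : r |: A = (r |: (A :\ j)) :|: [set j; r]); last first.
      apply/setP => t; rewrite !inE; case: (t =P j) => [->|_].
        by rewrite jA; case: eqP.
      by case: (t \in A); case: eqP.
    apply: (fiberU _ (pairJ j (fintype.subsetP AJ j jA) jr)).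
    apply: IHN; last by exists i.
      by apply: leq_trans leAN; rewrite [X in (_ < X)%N](cardsD1 j) jA.
    exact: fintype.subset_trans (finset.subsetDl _ _) AJ.
  rewrite (_ : r |: A = [set j; r]%SET); first exact: pairJ (fintype.subsetP AJ j jA) jr.
  apply/setP => t; rewrite !inE; case: (t =P r) => [_|/eqP tr]; rewrite ?orbT//= orbF.
  apply/idP/eqP => [tA|->//]; apply: contrapT => /eqP tj.
  by apply: no; exists t => //; rewrite !inE tj.
have fib2 (A : {set T}) : A \subset J -> (2 <= #|A|)%N -> fiber A E b !=set0.
  move=> AJ A2; have [rA|rA] := boolP (r \in A).
    have <- : r |: A = A by apply/finset.setUidPr; rewrite finset.sub1set.
    apply: fibr => //; have : (0 < #|A :\ r|)%N by move: A2; rewrite (cardsD1 r) rA.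
    by case/card_gt0P => j; rewrite !inE => /andP[jr jA]; exists j.
  have /card_gt0P[j jA] : (0 < #|A|)%N by apply: leq_trans A2.
  have jr : j != r by apply: contraNneq rA => <-.
  (* r is not in A: split A in two and exchange at r, which raises r *)
  have /card_gt0P[i] : (0 < #|A :\ j|)%N by move: A2; rewrite (cardsD1 j) jA.
  rewrite !inE => /andP[ij iA].
  have ir : i != r by apply: contraNneq rA => <-.
  rewrite (_ : A = ([set j; r] :|: (r |: (A :\ j))) :\ r); last first.
    apply/setP => t; rewrite !inE; have [->|tr] := eqVneq t r; first exact/negbTE.
    by rewrite /= orbF; case: (eqVneq t j) => [->|].
  apply: fiber_exchange (pairJ j (fintype.subsetP AJ j jA) jr) _.
    apply/setP => t; rewrite !inE; have [->|tr] := eqVneq t r; first by rewrite orbT.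
    by rewrite orbF /=; case: (t =P j).
  apply: fibr; first exact: fintype.subset_trans (finset.subsetDl _ _) AJ.
  by exists i; rewrite // !inE ij.
have imJ (A : {set idx J}) : val @: A \subset J.
  by apply/fintype.subsetP => _ /imsetP[j _ ->]; apply: valP.
have nJr : J <> [set r]%SET.
  move=> Jr; apply: (bE d0 Ed0 d0r) => t tr; apply: bJ => //.
  by rewrite Jr inE.
exists J => //; exists (pr J b); last first.
  by exists (Sub r rJ); rewrite ?ffunE ?SubK.
split; last first.
  move=> A A2; apply/(fiber_pr A bJ)/fib2 => //.
  by rewrite card_imset//; apply: val_inj.
split=> [|i]; last first.
  apply: contrapT => /eqP/set0P/(fiber_pr _ bJ); rewrite imset_set1 fib1; last exact: valP.
  by case.
have [|d [Ed dJ]] := fib2 J (subxx _).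
  rewrite ltnNge; apply/negP => J1; apply: nJr; apply/eqP.
  by rewrite eq_sym eqEcard finset.sub1set rJ cards1.
exists d => //; apply/ffunP => j; rewrite !ffunE.
by have := dJ (val j); rewrite (valP j).
Qed.

(** Above the conductor, each coordinate other than r is raised separately: an
    exchange with an element that agrees there and is larger elsewhere. *)
Lemma raise_above (c d B : {ffun T -> int}) :
  (forall b, le_vec c b -> E b) -> E d -> (forall t, t != r -> c t <= d t) ->
  exists2 e, E e & e r = d r /\ forall t, t != r -> B t <= e t.
Proof.
move=> above_c.
have [N] := ubnP (\sum_(t | t != r) absz (Num.max 0 (B t - d t))%R)%N.
elim: N d => // N IHN d lt_N Ed le_cd.
have [le_Bd|/existsNP[j /not_implyP[jr /negP]]] :=
  pselect (forall t, t != r -> B t <= d t); first by exists d.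
rewrite -ltNge => lt_dB.
pose f := [ffun t => if t == j then d j else Num.max (c t) (d t + 1)].
have Ef : E f.
  apply: above_c => t; rewrite ffunE; case: eqP => [->|_]; first exact: le_cd.
  by rewrite le_max lexx.
have [|e Ee [lt_j et]] := E_exchange (i := j) Ed Ef; first by rewrite ffunE eqxx.
have eE t : t != j -> e t = d t.
  by move=> tj; have := et t; rewrite ffunE (negPf tj) => -[_]; lia.
have [||e' Ee' [e'r le_e']] := IHN e _ Ee.
- rewrite -ltnS; apply: leq_trans lt_N.
  rewrite ltnS (bigD1 j)//= [X in (_ < X)%N](bigD1 j)//=.
  rewrite -addSn leq_add//; first by lia.
  by apply: leq_sum => t /andP[_ tj]; rewrite eE.
- by move=> t tr; have [->|/eE->] := eqVneq t j; [apply: le_trans (ltW lt_j) | ]; apply: le_cd.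
by exists e' => //; split=> //; rewrite e'r eE// eq_sym.
Qed.

Lemma relative_maximal_unreached (c : {ffun T -> int}) (J : {set T}) :
  (forall b, le_vec c b -> E b) ->
  pr_image r (relative_maximals (@pr T J @` E)) x ->
  ~ (exists2 d, E d & d r = x /\ forall t, t != r -> c t <= d t).
Proof.
move=> above_c [b [[_ bmax] _] [j jr xb]] [d Ed [dr le_cd]].
pose B : {ffun T -> int} := [ffun t => if insub t is Some i then b i + 1 else 0].
have [e Ee [er le_Be]] := raise_above B above_c Ed le_cd.
suff : fiber [set j]%SET (@pr T J @` E) b (pr J e) by rewrite bmax.
split=> [|i]; first by exists e.
rewrite inE !ffunE; case: eqP => [->|/eqP ij]; first by rewrite jr er dr xb.
have := le_Be (val i); rewrite -jr (inj_eq val_inj) => /(_ ij).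
by rewrite ffunE valK lezD1.
Qed.

End RelativeMaximals.

(** The sets of integers to count lie in an interval of length N that ends
    below z; they are enumerated downwards from z, as in
    [val_filtration_series_branch]. *)
Lemma card_countP (A : set int) (p : pred nat) (z : int) (N : nat) :
  (forall x, A x <-> exists2 i, (i < N)%N & p i /\ x = z - i.+1%:Z) ->
  (A #= `I_(count p (iota 0 N)))%card.
Proof.
move=> AP; pose s := filter p (iota 0 N).
have us : uniq s by rewrite filter_uniq ?iota_uniq.
have -> : A = (fun n => z - (nth 0%N s n).+1%:Z) @` `I_(count p (iota 0 N)).
  apply/seteqP; split=> [x /AP[i lt_iN [pi ->]]|_ [n /= lt_n <-]].
    have si : i \in s by rewrite mem_filter pi mem_iota.
    by exists (index i s); rewrite /= ?nth_index// -size_filter index_mem.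
  have : nth 0%N s n \in s by rewrite mem_nth// size_filter.
  by rewrite mem_filter mem_iota => /andP[pi lt_i]; apply/AP; exists (nth 0%N s n).
apply: inj_card_eq => m n; rewrite !inE /= -size_filter => lt_m lt_n /= e.
apply/eqP; rewrite -(nth_uniq 0%N lt_m lt_n us); apply/eqP.
by move: e; move: (nth _ _ m) (nth _ _ n); lia.
Qed.

Lemma count_partition3 (p q s : pred nat) N :
  (forall i, (i < N)%N -> (p i + q i + s i = 1)%N) ->
  (count p (iota 0 N) + count q (iota 0 N) + count s (iota 0 N) = N)%N.
Proof.
move=> pqs; rewrite -[RHS](size_iota 0 N).
have : {in iota 0 N, forall i, (p i + q i + s i = 1)%N}.
  by move=> i; rewrite mem_iota => /andP[_]; apply: pqs.
elim: (iota 0 N) => //= i l IHl pqsl.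
have := IHl (sub_in1 (fun j jl => mem_behead (s := i :: l) jl) pqsl).
have := pqsl i (mem_head _ _); lia.
Qed.

(** * The length formula *)

(* The curve has r = n.+1 branches, indexed by 'I_n.+1; the last one is
   ord_max. *)
Theorem theorem23 (k : closedFieldType) (O : comUnitAlgType k)
    (n : nat) (P : 'I_n.+1 -> set O) (K : 'I_n.+1 -> fieldType)
    (phi : forall i, {rmorphism O -> K i})
    (tau : forall i, {rmorphism powser k -> K i})
    (Idl : set (forall i, K i)) (alpha0 c gamma : {ffun 'I_n.+1 -> int})
    (r_ge3 : (3 <= n.+1)%N)
    (curveO : algebroid_curve O)
    (P_inj : injective P)
    (P_minimal : forall p : set O, minimal_prime p <-> exists i, P i = p)
    (branches : forall i, branch (P i) (phi i) (tau i))
    (ideal_Idl : fractional_ideal phi Idl)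
    (min_alpha0 : is_min (value_set tau Idl) alpha0)
    (cond_c : is_conductor (value_set tau Idl) c)
    (le_c_gamma : le_vec c gamma) :
  let E (J : {set 'I_n.+1}) := value_set (fun j => tau (val j)) (projK J Idl) in
  let I' := [set~ ord_max]%SET in
  exists l l' m u : nat,
    [/\ quotient_length phi Idl (val_filtration tau Idl gamma) l,
        quotient_length (fun j => phi (val j)) (projK I' Idl)
          (val_filtration (fun j => tau (val j)) (projK I' Idl) (pr I' gamma)) l',
        (gaps (pr_image ord_max (E [set ord_max]%SET)) #= `I_m)%card,
        ((\bigcup_(J in [set J : {set 'I_n.+1} |
                       ord_max \in J /\ J <> [set ord_max]%SET])
          pr_image ord_max (relative_maximals (E J))) #= `I_u)%card &
        l%:Z = l'%:Z + (gamma ord_max - alpha0 ord_max) - m%:Z - u%:Z].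
Proof.
move=> E I'.
have par := branch_parametrized branches.
have par' : parametrized (fun j : idx I' => phi (val j)) (fun j => tau (val j)).
  by move=> j; apply: par.
have [subI _ _] := ideal_Idl.
pose r : 'I_n.+1 := ord_max.
set V := value_set tau Idl in min_alpha0 cond_c.
have [[Valpha0 V_ge_alpha0] [[Vc above_c] _]] := (min_alpha0, cond_c).
have above_gamma b : le_vec gamma b -> V b.
  by move=> gb; apply: above_c => t; apply: le_trans (gb t).
have le_alpha0_gamma t : alpha0 t <= gamma t.
  by apply: le_trans (le_c_gamma t); apply: V_ge_alpha0.
have V_min := value_set_min par subI.
have V_exchange := value_set_exchange par subI above_c.
have EE J : E J = @pr _ J @` V by apply: (value_set_proj par subI above_c).
pose filt := val_filtration tau Idl.
pose I'filt := val_filtration (fun j : idx I' => tau (val j)) (projK I' Idl).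
pose reached x :=
  exists2 d, V d & d r = x /\ forall t, t != r -> gamma t <= d t.
pose Sr := pr_image r (E [set r]%SET).
pose U := \bigcup_(J in [set J : {set 'I_n.+1} | r \in J /\ J <> [set r]%SET])
  pr_image r (relative_maximals (E J)).
pose N := `|gamma r - alpha0 r|%N.
pose x_ i := gamma r - i.+1%:Z.
have SrP x : Sr x <-> exists2 d, V d & d r = x.
  rewrite /Sr EE; split=> [[_ [d Vd <-] [j jr ->]]|[d Vd dx]].
    by exists d => //; rewrite ffunE jr.
  exists (pr [set r]%SET d); first by exists d.
  by exists (Sub r (set11 r)); rewrite ?ffunE SubK.
have Sr_ge x : Sr x -> alpha0 r <= x.
  by move=> /SrP[d /V_ge_alpha0/(_ r) + <-].
have reached_Sr x : reached x -> Sr x.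
  by move=> [d Vd [dx _]]; apply/SrP; exists d.
have reached_ge x : gamma r <= x -> reached x.
  move=> le_x; exists (upd gamma r x); last first.
    by split=> [|t /negPf tr]; rewrite ffunE ?eqxx ?tr.
  by apply: above_gamma => t; rewrite ffunE; case: eqP => [->|].
have U_Sr x : U x -> Sr x.
  move=> [J _ [b [[+ _] _] [j jr ->]]]; rewrite EE => -[d Vd <-].
  by apply/SrP; exists d => //; rewrite ffunE jr.
have U_unreached x : U x -> ~ reached x.
  by move=> [J _]; rewrite EE; apply: relative_maximal_unreached.
have unreached_U x : Sr x -> ~ reached x -> U x.
  move=> /SrP Vx /(relative_maximal_over V_min V_exchange V_ge_alpha0 Vx)[J Jr Jx].
  by exists J; rewrite ?EE.
(* unreached values lie in the interval over which the lengths are counted *)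
have range x : alpha0 r <= x -> ~ reached x -> exists2 i, (i < N)%N & x = x_ i.
  move=> le_x nx; have lt_x : x < gamma r by rewrite ltNge; apply/negP => /reached_ge.
  by exists (`|gamma r - x|%N.-1); rewrite /x_; lia.
have gapsP x : gaps Sr x <-> alpha0 r <= x /\ ~ Sr x.
  have S0 : Sr (alpha0 r) by apply/SrP; exists alpha0.
  split=> [[nSx [m [Sm _ /ltW lt_mx]]]|[le_x nSx]].
    by split=> //; apply: le_trans lt_mx; apply: Sr_ge.
  split=> //; exists (alpha0 r); split=> //.
  by rewrite lt_neqAle le_x andbT; apply: contra_notN nSx => /eqP<-.
have x_ge i : (i < N)%N -> alpha0 r <= x_ i.
  by have := le_alpha0_gamma r; rewrite /N /x_; lia.
have sub' : submodule (fun j : idx I' => phi (val j)) (projK I' Idl).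
  split; first by exists (fun=> 0) => //; case: subI.
  move=> a _ _ [h Ih <-] [g Ig <-].
  by exists (fun t => phi t a * h t + g t) => //; apply: subI.2.
have le_pr : le_vec (pr I' alpha0) (pr I' gamma) by move=> j; rewrite !ffunE.
have topE : I'filt (pr I' alpha0) = projK I' Idl.
  apply/seteqP; split=> [h []//|_ [h Ih <-]]; split=> [|j]; first by exists h.
  by rewrite ffunE; case: (value_set_lower par subI above_c V_ge_alpha0 Ih).
have [l' s'] : exists l', series (fun j : idx I' => phi (val j))
    (I'filt (pr I' gamma)) (projK I' Idl) l'.
  by rewrite -[X in series _ _ X]topE; apply: val_filtration_series par' _ sub' _ _ le_pr.
have s1 : series phi (filt (upd gamma r (alpha0 r))) Idl l'.
  have := series_pullback subI (@subset_refl _ _) s'.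
  rewrite (_ : [set h | Idl h /\ projK I' Idl _] = Idl); last first.
    by apply/seteqP; split=> [h []//|h Ih]; split=> //; exists h.
  rewrite (_ : [set h | Idl h /\ _] = filt (upd gamma r (alpha0 r)))//.
  apply/seteqP; split=> [h [Ih [_ hge]]|h [Ih hge]]; split=> //.
    move=> t; rewrite ffunE; case: eqP => [->|/eqP tr].
      by case: (value_set_lower par subI above_c V_ge_alpha0 Ih).
    have tI : t \in I' by rewrite !inE.
    by have := hge (Sub t tI); rewrite ffunE SubK.
  split=> [|j]; first by exists h.
  have := hge (val j); rewrite !ffunE ifN//.
  by have := valP j; rewrite !inE.
have s2 := val_filtration_series_branch par subI gamma r N.
have s := series_cat s2; rewrite (_ : gamma r - N%:Z = alpha0 r) in s; last first.
  by have := le_alpha0_gamma r; rewrite /N; lia.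
have {s s1 s2 s'} [s s'] := (s _ _ s1, s').
set m := count _ _ in s.
have mE : m = count (fun i => `[< reached (x_ i) >]) (iota 0 N).
  apply: eq_count => i; apply: asbool_equiv_eq; split.
    move=> [h [Ih hge] hr].
    have [e Ve eP] := value_set_regularize par subI above_c gamma Ih.
    have eqe t y : val_eq (tau t) (h t) y -> e t = y.
      have [tau_inj _ _ _] := par t => hy.
      apply: (val_eq_uniq tau_inj _ hy); apply: (eP t).1.
      exact: (val_eq_neq0 tau_inj hy).
    exists e => //; split=> [|t /negPf tr]; first exact: eqe.
    have := hge t; rewrite ffunE tr => -[ht|[y le_y hy]]; first exact: (eP t).2.
    by rewrite (eqe _ _ hy).
  move=> [d [h Ih hd] [dr le_d]]; exists h; last by rewrite -/(x_ i) -dr.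
  split=> // t; rewrite ffunE; case: eqP => [->|/eqP/le_d le_t].
    by apply: val_eq_ge (hd r); rewrite dr.
  exact: val_eq_ge (hd t).
exists (l' + m)%N, l', (count (fun i => `[< gaps Sr (x_ i) >]) (iota 0 N)),
  (count (fun i => `[< U (x_ i) >]) (iota 0 N)).
split.
- exact: series_length s.
- exact: series_length s'.
- apply: card_countP => x; split=> [gx|[i _ [/asboolP gi ->]]]; last exact: gi.
  have [le_x nSx] := (gapsP x).1 gx.
  have [i lt_i xi] := range x le_x (fun rx => nSx (reached_Sr x rx)).
  by exists i => //; split; [apply/asboolP; move: gx; rewrite xi | exact: xi].
- apply: card_countP => x; split=> [Ux|[i _ [/asboolP Ui ->]]]; last exact: Ui.
  have [i lt_i xi] := range x (Sr_ge _ (U_Sr x Ux)) (U_unreached x Ux).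
  by exists i => //; split; [apply/asboolP; move: Ux; rewrite xi | exact: xi].
- have part i : (i < N)%N ->
      (`[< reached (x_ i) >] + `[< gaps Sr (x_ i) >] + `[< U (x_ i) >] = 1)%N.
    move=> /x_ge le_x; have [Sx|nSx] := pselect (Sr (x_ i)); last first.
      rewrite (asboolT ((gapsP _).2 (conj le_x nSx))).
      by rewrite !asboolF// => ?; apply: nSx; [apply: U_Sr | apply: reached_Sr].
    rewrite (@asboolF (gaps _ _)); last by case/gapsP.
    have [rx|nrx] := pselect (reached (x_ i)).
      by rewrite asboolT// asboolF// => /U_unreached.
    by rewrite asboolF// asboolT//; apply: unreached_U.
  have NE : gamma ord_max - alpha0 ord_max = N%:Z.
    by have := le_alpha0_gamma r; rewrite /N /r; lia.
  have := count_partition3 part; rewrite -mE NE.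
  lia.
Qed.
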